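(* Let $G$ be a 2-connected, linear-convex supergrid graph. Then $G$ is locally connected, i.e., for every vertex $u$ of $G$, the subgraph of $G$ induced by the neighbourhood $N(u)$ of $u$ is connected.
   Context: The two-dimensional supergrid $S^\infty$ is the infinite graph whose vertex set is $\mathbb{Z}^2$, in which two distinct vertices $(a,b)$ and $(c,d)$ are adjacent if and only if $|a-c|\le 1$ and $|b-d|\le 1$. A supergrid graph is a finite vertex-induced subgraph of $S^\infty$. A supergrid graph $G$ is linear-convex if for every line $l$ in the plane that contains an edge of $S^\infty$ (every horizontal, vertical, slope $+1$ or slope $-1$ line through integer points), the intersection of $l$ with $G$ is either empty, a single vertex, or a line segment forming a path of $G$; equivalently, the vertices of $G$ on $l$ form a (possibly empty) set of consecutive lattice points of $l$. A graph is 2-connected if there are two internally vertex-disjoint paths between every pair of its vertices (with the standard convention that it has at least three vertices). $N(u)$ denotes the set of vertices adjacent to $u$. *)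

(* Defs.v *)
From mathcomp Require Import all_boot all_order all_algebra finmap.

Set Implicit Arguments.
Unset Strict Implicit.
Unset Printing Implicit Defensive.

Import Order.TTheory GRing.Theory Num.Theory.

Local Open Scope ring_scope.

(* Finite simple graphs are given by an adjacency relation on a finType. *)
Section Graphs.

Variables (T : finType) (e : rel T).

Definition simple_path (x y : T) (p : seq T) : bool :=
  [&& path e x p, last x p == y & uniq (x :: p)].

(* For a path x :: p, all vertices except the first and the last. *)
Definition internal_vertices (x : T) (p : seq T) : seq T := behead (belast x p).

(* The condition p != q matters only when x and y are adjacent: the edge xy is
   internally disjoint from itself, but counts as a single path. *)
Definition two_connected : Prop :=
  (2 < #|T|)%N /\
  forall x y : T, x != y ->
    exists p q : seq T,
      [/\ simple_path x y p, simple_path x y q, p != q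
        & [disjoint internal_vertices x p & internal_vertices x q]].

Definition neighbourhood (u : T) : {set T} := [set v | e u v].

(* The graph with no vertices is not considered connected. *)
Definition induced_connected (A : {set T}) : Prop :=
  A != set0 /\
  {in A &, forall x y,
     connect [rel a b | [&& a \in A, b \in A & e a b]] x y}.

Definition locally_connected : Prop :=
  forall u : T, induced_connected (neighbourhood u).

End Graphs.

Definition supergrid_adj : rel (int * int) :=
  fun p q => [&& p != q, `|p.1 - q.1| <= 1 & `|p.2 - q.2| <= 1].

(* A supergrid graph is determined by its finite vertex set V; its vertices are
   the elements of the finType associated with V. *)
Definition supergrid_graph (V : {fset int * int}) : rel V :=
  fun u v => supergrid_adj (val u) (val v).

Definition line_directions : seq (int * int) :=
  [:: (1, 0); (0, 1); (1, 1); (1, -1)].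

(* The lattice points of the line through p with direction d are p + d *~ i for
   i : int. Those lying in V are the n consecutive ones starting at index a;
   n = 0 and n = 1 are the empty and the single-vertex intersections. *)
Definition linear_convex (V : {fset int * int}) : Prop :=
  forall p d : int * int, d \in line_directions ->
    exists (a : int) (n : nat),
      forall i : int, (p + d *~ i \in V) = (a <= i < a + n%:Z).

(* Main.v *)
(** Deleting [u] leaves [G] connected. If the neighbours of [u] straddle the
    vertical (or horizontal) line through [u] and both neighbours of [u] on that
    line are missing, then by convexity the line meets [G] in [u] only, so [u]
    would be a cut vertex. If a corner neighbour [u + (s, t)] is present while
    [u + (s, 0)] and [u + (0, t)] are missing, then by convexity the boundary of
    the quadrant at [u] containing that corner meets [G] in [u] only, so the
    corner is the only neighbour of [u]. Hence, unless [u] has a single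
    neighbour, every neighbour of [u] is equal or adjacent to one of the present
    neighbours [u + (s, 0)], [u + (0, t)], and any two of these are joined
    inside [N(u)]. *)
Require Import Defs.
From mathcomp Require Import all_boot all_order all_algebra finmap.
From mathcomp Require Import zify.

Set Implicit Arguments.
Unset Strict Implicit.
Unset Printing Implicit Defensive.

Import Order.TTheory GRing.Theory Num.Theory.

Local Open Scope ring_scope.

(** * Paths in 2-connected graphs *)

Lemma mem_internal_vertices (T : finType) (e : rel T) (x y u : T) (p : seq T) :
  simple_path e x y p -> u != y -> u \in p -> u \in internal_vertices x p.
Proof.
case: p => [|z p] // /and3P[_ /eqP /= ylast _] uy.
by rewrite /internal_vertices /= lastI mem_rcons inE ylast (negPf uy).
Qed.

Lemma path_crossing (T : eqType) (e : rel T) (S : pred T) (x : T) (p : seq T) :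
  path e x p -> S x -> ~~ S (last x p) ->
  exists a b, [/\ a \in x :: p, b \in p, e a b, S a & ~~ S b].
Proof.
elim: p x => [|z p IHp] x /=; first by move=> _ ->.
case/andP=> exz pz Sx nSl; case: (boolP (S z)) => [Sz|nSz]; last first.
  by exists x, z; split; rewrite ?inE ?eqxx.
have [a [b [ap bp eab Sa nSb]]] := IHp z pz Sz nSl.
by exists a, b; split=> //; rewrite inE ?ap ?bp orbT.
Qed.

(** This is the usable form of connectedness after deleting [u]. Since [u] is neither endpoint, it
    cannot lie on both internally disjoint paths, and the path avoiding [u] must leave [S] along
    some edge. *)
Lemma two_connected_crossing (T : finType) (e : rel T) (u x y : T)
    (S : pred T) :
  two_connected e -> u != x -> u != y -> S x -> ~~ S y ->
  exists a b, [/\ a != u, b != u, e a b, S a & ~~ S b].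
Proof.
move=> [_ conn] ux uy Sx nSy.
have xy : x != y by apply: contraNneq nSy => <-.
have [p [q [sp sq _ dpq]]] := conn x y xy.
have [r sr ur] : exists2 r, simple_path e x y r & u \notin r.
  case: (boolP (u \in p)) => up; last by exists p.
  exists q => //; apply/negP => uq.
  move/pred0P/(_ u): dpq => /=.
  by rewrite (mem_internal_vertices sp uy up) (mem_internal_vertices sq uy uq).
case/and3P: sr => pr /eqP lr _; rewrite -lr in nSy.
have [a [b [ar br eab Sa nSb]]] := path_crossing pr Sx nSy.
exists a, b; split=> //; last by apply: contraNneq ur => <-.
by move: ar; rewrite inE; apply: contraTneq => ->; rewrite negb_or ux.
Qed.

Lemma two_connected_neighbour (T : finType) (e : rel T) (u : T) :
  two_connected e -> exists v, e u v.
Proof.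
move=> [cardT conn].
have [y uy] : exists y, y != u.
  apply/existsP; rewrite -negb_forall; apply: contraTN cardT => /forallP all_u.
  rewrite -leqNgt ltnW //; apply/fintype_le1P => z.
  have /eqP zu : z == u by exact: all_u.
  by move=> w; apply/eqP; rewrite zu; exact: all_u.
rewrite eq_sym in uy; have [[|v p] [q [sp _ _ _]]] := conn u y uy.
  by case/and3P: sp => _ /eqP /= uy'; rewrite uy' eqxx in uy.
by case/and3P: sp => /andP[euv _] _ _; exists v.
Qed.

(** * Adjacency and convexity in coordinates *)

Lemma supergrid_adjC : symmetric supergrid_adj.
Proof.
by move=> p q; rewrite /supergrid_adj eq_sym (distrC p.1) (distrC p.2).
Qed.

Lemma supergrid_adjP (p q : int * int) :
  reflect [/\ p.1 <> q.1 \/ p.2 <> q.2, p.1 - 1 <= q.1 <= p.1 + 1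
            & p.2 - 1 <= q.2 <= p.2 + 1]
          (supergrid_adj p q).
Proof.
case: p q => [p1 p2] [q1 q2]; rewrite /supergrid_adj xpair_eqE /=.
by apply: (iffP and3P) => -[]; split; lia.
Qed.

Lemma pairMz (M1 M2 : zmodType) (x : M1 * M2) (m : int) :
  x *~ m = (x.1 *~ m, x.2 *~ m).
Proof.
case: m => m; first by rewrite -!pmulrn pairMnE.
by rewrite NegzE !mulrNz -!pmulrn pairMnE.
Qed.

Section LinearConvex.

Variable V : {fset int * int}.
Hypothesis convV : linear_convex V.

Lemma row_convex (x1 x2 x3 y : int) :
  (x1, y) \in V -> (x3, y) \in V -> x1 <= x2 <= x3 -> (x2, y) \in V.
Proof.
(* With base point [(0, y)], the index along the line is the first coordinate itself. *)
have [|a [n Vrow]] := convV (0, y) (d := (1, 0)); first by [].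
have Vx x : ((x, y) \in V) = (a <= x < a + n%:Z).
  rewrite -Vrow; congr (_ \in V).
  by rewrite pairMz /= intz mul0rz; congr pair; rewrite /= ?add0r ?addr0.
by rewrite !Vx; lia.
Qed.

Lemma column_convex (x y1 y2 y3 : int) :
  (x, y1) \in V -> (x, y3) \in V -> y1 <= y2 <= y3 -> (x, y2) \in V.
Proof.
have [|a [n Vcol]] := convV (x, 0) (d := (0, 1)); first by [].
have Vy y : ((x, y) \in V) = (a <= y < a + n%:Z).
  rewrite -Vcol; congr (_ \in V).
  by rewrite pairMz /= intz mul0rz; congr pair; rewrite /= ?add0r ?addr0.
by rewrite !Vy; lia.
Qed.

(** * Separation by lines and quadrants at [u = (x, y)] *)

Hypothesis connV : two_connected (@supergrid_graph V).

Variables x y : int.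
Hypothesis Vu : (x, y) \in V.

Lemma supergrid_crossing (S : pred (int * int)) (p q : int * int) :
  p \in V -> q \in V -> p <> (x, y) -> q <> (x, y) -> S p -> ~~ S q ->
  exists a b, [/\ a \in V, b \in V, a <> (x, y) /\ b <> (x, y),
                  supergrid_adj a b & S a && ~~ S b].
Proof.
move=> Vp Vq pu qu Sp nSq; pose u : V := [` Vu]%fset.
have neq (z : V) : (u != z) = (val z != (x, y)) by rewrite eq_sym -val_eqE.
have [||||a [b [au bu eab Sa nSb]]] := two_connected_crossing
  (u := u) (x := [` Vp]%fset) (y := [` Vq]%fset) (S := S \o val) connV.
- by rewrite neq; apply/eqP.
- by rewrite neq; apply/eqP.
- by [].
- by [].
exists (val a), (val b); split; try exact: valP; last by apply/andP.
  by split; apply/eqP; rewrite -neq eq_sym.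
exact: eab.
Qed.

(** An edge leaving the open half-plane to the left of [u] ends on the column of [u]. Its end
    differs from [u], so column convexity would put [(x, y + 1)] or [(x, y - 1)] in [V]. *)
Lemma column_separates (p q : int * int) :
  (x, y + 1) \notin V -> (x, y - 1) \notin V -> p \in V -> q \in V ->
  p.1 < x < q.1 -> False.
Proof.
move=> nN nS Vp Vq pxq.
have [|||| [a1 a2] [[b1 b2] [Va Vb [_ bu] /supergrid_adjP[_ /= ab1 _]]]] :=
    supergrid_crossing (S := fun z => z.1 < x) Vp Vq.
- by move=> pu; rewrite pu /= in pxq; lia.
- by move=> qu; rewrite qu /= in pxq; lia.
- by case/andP: pxq.
- by rewrite -leNgt ltW //; case/andP: pxq.
move=> ab; have b1x : b1 = x by lia.
rewrite {}b1x in Vb bu.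
case: (ltgtP b2 y) => b2y; last by rewrite b2y in bu.
  by case/negP: nS; apply: (column_convex Vb Vu); lia.
by case/negP: nN; apply: (column_convex Vu Vb); lia.
Qed.

Lemma row_separates (p q : int * int) :
  (x + 1, y) \notin V -> (x - 1, y) \notin V -> p \in V -> q \in V ->
  p.2 < y < q.2 -> False.
Proof.
move=> nE nW Vp Vq pyq.
have [|||| [a1 a2] [[b1 b2] [Va Vb [_ bu] /supergrid_adjP[_ _ /= ab2]]]] :=
    supergrid_crossing (S := fun z => z.2 < y) Vp Vq.
- by move=> pu; rewrite pu /= in pyq; lia.
- by move=> qu; rewrite qu /= in pyq; lia.
- by case/andP: pyq.
- by rewrite -leNgt ltW //; case/andP: pyq.
move=> ab; have b2y : b2 = y by lia.
rewrite {}b2y in Vb bu.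
case: (ltgtP b1 x) => b1x; last by rewrite b1x in bu.
  by case/negP: nW; apply: (row_convex Vb Vu); lia.
by case/negP: nE; apply: (row_convex Vu Vb); lia.
Qed.

Lemma quadrant_separates (s t : int) (q : int * int) :
  s = 1 \/ s = -1 -> t = 1 \/ t = -1 ->
  (x + s, y) \notin V -> (x, y + t) \notin V -> (x + s, y + t) \in V ->
  q \in V -> supergrid_adj (x, y) q -> q = (x + s, y + t).
Proof.
move=> s1 t1 nH nK Vp Vq /supergrid_adjP[/= qu q1 q2].
(* [S] is the open quadrant at [u] towards the corner, which is the only point of [S] adjacent to
   [u]. *)
pose S (z : int * int) := (0 < s * (z.1 - x)) && (0 < t * (z.2 - y)).
case: (boolP (S q)) => [|nSq].
  rewrite /S (surjective_pairing q) /=.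
  by case: s1 t1 => [] -> [] -> Sq; congr pair; lia.
have [|||| [a1 a2] [[b1 b2] [Va Vb [_ bu] /supergrid_adjP[_ /= ab1 ab2]]]] :=
    supergrid_crossing (S := S) Vp Vq.
- by case; case: s1 => ->; lia.
- by move=> qxy; rewrite qxy /= in qu; case: qu.
- by rewrite /S /=; case: s1 t1 => [] -> [] ->; lia.
- exact: nSq.
rewrite /S /= => Sab.
(* An edge leaving the open quadrant ends on one of its two closed boundary rays. As [b] is not [u],
   convexity along that ray yields the point next to [u] that was assumed missing. *)
have [[b1x sb2]|[b2y sb1]] : b1 = x /\ 0 <= t * (b2 - y) \/
    b2 = y /\ 0 <= s * (b1 - x) by case: s1 t1 Sab => [] -> [] ->; lia.
  rewrite {}b1x in Vb bu; have b2y : b2 <> y by move=> b2y; rewrite b2y in bu.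
  case/negP: nK; case: t1 sb2 => [] -> sb2.
    by apply: (column_convex Vu Vb); lia.
  by apply: (column_convex Vb Vu); lia.
rewrite {}b2y in Vb bu; have b1x : b1 <> x by move=> b1x; rewrite b1x in bu.
case/negP: nH; case: s1 sb1 => [] -> sb1.
  by apply: (row_convex Vu Vb); lia.
by apply: (row_convex Vb Vu); lia.
Qed.

(** * Horizontal and vertical neighbours of [u] *)

Definition axial (a : int * int) : Prop := a.1 = x \/ a.2 = y.

(** The second neighbour [b] rules out the case where a corner [a] is the only neighbour of [u].
    Otherwise one of the two projections of the corner [a] onto the axes through [u] serves as
    [c]. *)
Lemma axial_or_near_axial (a b : int * int) :
  a \in V -> b \in V -> supergrid_adj (x, y) a -> supergrid_adj (x, y) b ->
  a <> b ->
  exists c, [/\ c \in V, axial c, supergrid_adj (x, y) c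
              & a = c \/ supergrid_adj a c].
Proof.
case: a => a1 a2 Va Vb ua ub ab.
case: (boolP ((a1 == x) || (a2 == y))) => [axa|naxa].
  exists (a1, a2); split=> //; last by left.
  by case/orP: axa => /eqP; [left | right].
have [/= _ xa ya] := supergrid_adjP _ _ ua.
case: (boolP ((a1, y) \in V)) => [Vc|nH].
  by exists (a1, y); split=> //; [right | | right];
    try (apply/supergrid_adjP; split); rewrite /=; lia.
case: (boolP ((x, a2) \in V)) => [Vc|nK].
  by exists (x, a2); split=> //; [left | | right];
    try (apply/supergrid_adjP; split); rewrite /=; lia.
(* Both projections are missing, so [quadrant_separates] with [s = a1 - x] and [t = a2 - y] forces
   [b = a]. *)
case: ab; have xs : x + (a1 - x) = a1 by lia.
have ys : y + (a2 - y) = a2 by lia.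
rewrite -xs -ys; apply/esym.
by apply: quadrant_separates; rewrite ?xs ?ys //; lia.
Qed.

(** Distinct, non-adjacent axial neighbours lie on opposite sides of [u]. Either neighbour of [u] on
    the perpendicular axis is adjacent to both, and the separation lemmas show that one of these is
    present. *)
Lemma axial_joined (a b : int * int) :
  a \in V -> b \in V -> supergrid_adj (x, y) a -> supergrid_adj (x, y) b ->
  axial a -> axial b ->
  [\/ a = b, supergrid_adj a b
    | exists m, [/\ m \in V, supergrid_adj (x, y) m, supergrid_adj a m
                  & supergrid_adj m b]].
Proof.
case: a b => [a1 a2] [b1 b2] Va Vb ua ub; rewrite /axial /= => axa axb.
have [/= nua ua1 ua2] := supergrid_adjP _ _ ua.
have [/= nub ub1 ub2] := supergrid_adjP _ _ ub.
case: (boolP (supergrid_adj (a1, a2) (b1, b2))) => [|/supergrid_adjP nab].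
  by constructor 2.
have {}nab : a1 - 1 <= b1 <= a1 + 1 -> a2 - 1 <= b2 <= a2 + 1 ->
    a1 = b1 /\ a2 = b2.
  by move=> b1a b2a; case: (eqVneq a1 b1) (eqVneq a2 b2) => [] ? [] ? //;
    case: nab; split=> //=; lia.
have [[-> ->]|ab] : (a1 = b1 /\ a2 = b2) \/
    (a1 = x /\ b1 = x) /\ ((a2 < y < b2) \/ (b2 < y < a2)) \/
    (a2 = y /\ b2 = y) /\ ((a1 < x < b1) \/ (b1 < x < a1)) by lia.
  by constructor 1.
constructor 3.
have via m1 m2 : (m1, m2) \in V -> m1 <> x \/ m2 <> y ->
    x - 1 <= m1 <= x + 1 -> y - 1 <= m2 <= y + 1 ->
    (m1 = x /\ a2 = y /\ b2 = y) \/ (m2 = y /\ a1 = x /\ b1 = x) ->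
    exists m, [/\ m \in V, supergrid_adj (x, y) m, supergrid_adj (a1, a2) m
                & supergrid_adj m (b1, b2)].
  move=> Vm *; exists (m1, m2).
  by split=> //; apply/supergrid_adjP; split=> /=; lia.
case: ab => -[[ax bx] ab].
  case: (boolP ((x + 1, y) \in V)) => [Vm|nE].
    by apply: (via _ _ Vm); lia.
  case: (boolP ((x - 1, y) \in V)) => [Vm|nW].
    by apply: (via _ _ Vm); lia.
  have sep p q := @row_separates p q nE nW.
  by case: ab; [have := sep _ _ Va Vb | have := sep _ _ Vb Va].
case: (boolP ((x, y + 1) \in V)) => [Vm|nN]; first by apply: (via _ _ Vm); lia.
case: (boolP ((x, y - 1) \in V)) => [Vm|nS]; first by apply: (via _ _ Vm); lia.
have sep p q := @column_separates p q nN nS.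
by case: ab; [have := sep _ _ Va Vb | have := sep _ _ Vb Va].
Qed.

End LinearConvex.

(** * Connecting paths inside [N(u)] *)

Theorem theorem1 (V : {fset int * int}) :
  two_connected (@supergrid_graph V) ->
  linear_convex V ->
  locally_connected (@supergrid_graph V).
Proof.
move=> connV convV [[x y] Vu]; set A := neighbourhood _ _.
have AE a : (a \in A) = supergrid_adj (x, y) (val a) by rewrite inE.
split.
  have [v uv] := two_connected_neighbour [` Vu]%fset connV.
  by apply/set0Pn; exists v; rewrite AE.
pose r := [rel a b | [&& a \in A, b \in A & supergrid_graph a b]].
have connA a b : a \in A -> b \in A -> supergrid_adj (val a) (val b) ->
  connect r a b by move=> Aa Ab eab; apply/connect1/and3P; split.
have axial_conn a b : a \in A -> b \in A -> axial x y (val a) ->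
    axial x y (val b) -> connect r a b.
  move=> Aa Ab axa axb; have [||/val_inj->|ab|[m [Vm um am mb]]] :=
    axial_joined convV connV Vu (valP a) (valP b) _ _ axa axb.
  - by rewrite -(AE a).
  - by rewrite -(AE b).
  - exact: connect0.
  - exact: connA.
  have Am : [` Vm]%fset \in A by rewrite AE.
  exact: connect_trans (connA _ _ Aa Am am) (connA _ _ Am Ab mb).
have axial_near a b : a \in A -> b \in A -> a != b ->
    exists2 c, c \in A & axial x y (val c) /\ connect r a c.
  move=> Aa Ab ab.
  have [|||c [Vc axc uc ac]] :=
    axial_or_near_axial convV connV Vu (valP a) (valP b).
  - by rewrite -(AE a).
  - by rewrite -(AE b).
  - by move/val_inj/eqP; rewrite (negPf ab).
  have Ac : [` Vc]%fset \in A by rewrite AE.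
  exists [` Vc]%fset => //; split=> //.
  case: ac => [ac|ac]; last exact: (connA a [` Vc]%fset Aa Ac ac).
  by have -> : a = [` Vc]%fset by apply: val_inj.
(* The path runs from [a] to an axial [c], then to an axial [d], then to [b]. Each of [a] and [b] is
   the second neighbour that [axial_near] requires for the other. *)
move=> a b Aa Ab; case: (eqVneq a b) => [->|ab]; first exact: connect0.
have [c Ac [axc ac]] := axial_near a b Aa Ab ab.
rewrite eq_sym in ab; have [d Ad [axd bd]] := axial_near b a Ab Aa ab.
have symr : connect_sym r.
  apply: sym_connect_sym => p q /=.
  by rewrite /supergrid_graph supergrid_adjC andbCA.
rewrite symr in bd.
exact: connect_trans ac (connect_trans (axial_conn c d Ac Ad axc axd) bd).
Qed.
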